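(* For any odd prime $p$, we have $$\left(\frac{D_p(2,-1)}{p}\right)=-1\iff p\equiv 5\pmod 8.$$
   Context: For an odd prime $p$, $\left(\frac{\cdot}{p}\right)$ denotes the Legendre symbol (equal to $0$ on multiples of $p$). For $b,c\in\mathbb{Z}$, $D_p(b,c)$ denotes the integer determinant of the $(p-1)\times(p-1)$ matrix with $(i,j)$ entry $(i^2+bij+cj^2)^{p-2}$: $$D_p(b,c)=\left|(i^2+bij+cj^2)^{p-2}\right|_{1\le i,j\le p-1}.$$ *)

(* Defs.v *)
From mathcomp Require Import all_boot all_order all_algebra.

Set Implicit Arguments.
Unset Strict Implicit.
Unset Printing Implicit Defensive.

Import GRing.Theory.
Local Open Scope ring_scope.

(* The Legendre symbol (a / p); meaningful for p an odd prime. *)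
Definition legendre (a : int) (p : nat) : int :=
  if (p %| a)%Z then 0
  else if [exists x : 'I_p, ((x%:Z ^+ 2) == a %[mod p])%Z] then 1
  else -1.

(* Ordinals start at 0, so the index pair (i, j) of the usual
   1 <= i, j <= p - 1 convention is (i.+1, j.+1) here. *)
Definition Dmx (p : nat) (b c : int) : 'M[int]_(p.-1) :=
  \matrix_(i < p.-1, j < p.-1)
    (i.+1%:Z ^+ 2 + b * i.+1%:Z * j.+1%:Z + c * j.+1%:Z ^+ 2) ^+ (p - 2).

Definition D (p : nat) (b c : int) : int := \det (Dmx p b c).

(* Main.v *)
Require Import Defs.
From mathcomp Require Import all_boot all_order all_algebra all_field.
From mathcomp Require Import ring zify.

(* Modulo p the (i, j) entry of the matrix is 1 / (i^2 + 2ij - j^2) (with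
   1/0 = 0), that is i^-1 j^-1 h(i/j) with h(x) = x / (x^2 + 2x - 1).  The
   matrix h(i/j) is a group matrix of the cyclic group F_p^*, so its determinant
   is the product of the coefficients e_0, ..., e_(p-2) of the expansion of h
   in powers of x^-1 on F_p^*.  Since h(-1/x) = h(x), e_(p-1-n) = (-1)^n e_n.
   Write k = (p-1)/2.
   - If k is odd then e_k = 0.
   - If k is even then -1 is a square and D_p(2,-1) is e_0 e_k times a square.
     Partial fractions with poles a, b = -1 +- sqrt 2 give e_0 and e_k:
     + if p = 1 mod 8 then sqrt 2 is in F_p, e_0 = 1/4 and e_k = +-1/4, where
       -1 is a fourth power;
     + if p = 5 mod 8 then a and b are conjugate, 8 e_n = a^(n+1) + b^(n+1) is
       never 0, e_0 = -1/4, and 4 e_k is a square root of -1, a nonsquare. *)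

Set Implicit Arguments.
Unset Strict Implicit.
Unset Printing Implicit Defensive.

Import GRing.Theory.
Local Open Scope ring_scope.

(** * Power sums over a finite field *)

Lemma card_finField_gt0 (F : finFieldType) : (0 < #|F|)%N.
Proof. by apply/card_gt0P; exists 0. Qed.

Lemma natr_card_finField (F : finFieldType) : #|F|%:R = 0 :> F.
Proof.
have : \sum_(x : F) x = \sum_(x : F) (1 + x) by rewrite (reindex_inj (addrI 1)).
rewrite big_split /= sumr_const => /eqP.
by rewrite -subr_eq subrr eq_sym => /eqP.
Qed.

Lemma natr_card_finField_pred (F : finFieldType) : #|F|.-1%:R = -1 :> F.
Proof.
apply/eqP; rewrite -addr_eq0 natr1 prednK ?card_finField_gt0 //.
by rewrite natr_card_finField.
Qed.

Lemma expf_card_pred (F : finFieldType) (x : F) : x != 0 -> x ^+ #|F|.-1 = 1.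
Proof.
move=> x0; apply: (mulfI x0).
by rewrite mulr1 -exprS prednK ?card_finField_gt0 // expf_card.
Qed.

Lemma exists_expf_neq1 (F : finFieldType) (k : nat) :
  (0 < k < #|F|.-1)%N -> exists2 a : F, a != 0 & a ^+ k != 1.
Proof.
case/andP=> k0 kF.
have [/existsP[a /andP[]]|] := boolP [exists a : F, (a != 0) && (a ^+ k != 1)].
  by exists a.
rewrite negb_exists => /forallP H; move: kF.
rewrite ltnNge -(cardC1 (0 : F)) cardE max_unity_roots ?enum_uniq //.
apply/allP=> a; rewrite mem_enum inE => a0; apply/unity_rootP.
by have := H a; rewrite a0 /= negbK => /eqP.
Qed.

(** For [k > 0], scaling by some [a] with [a ^+ k != 1] permutes [F] and multiplies the sum by
    [a ^+ k]. For [k = 0] the sum is [#|F|], which is 0 in [F]. *)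
Lemma sum_expf (F : finFieldType) (k : nat) :
  (k < #|F|.-1)%N -> \sum_(x : F) x ^+ k = 0.
Proof.
case: k => [|k] kF.
  under eq_bigr do rewrite expr0.
  by rewrite sumr_const natr_card_finField.
have [a a0 ak] := exists_expf_neq1 (k := k.+1) kF.
have : \sum_(x : F) x ^+ k.+1 = a ^+ k.+1 * \sum_(x : F) x ^+ k.+1.
  rewrite {1}(reindex_inj (mulfI a0)) mulr_sumr.
  by apply: eq_bigr => x _; rewrite exprMn.
move/eqP; rewrite -subr_eq0 -{1}[\sum_x _]mul1r -mulrBl mulf_eq0 subr_eq0.
by rewrite eq_sym (negPf ak) => /eqP.
Qed.

Lemma sum_expf_card_pred (F : finFieldType) :
  (2 < #|F|)%N -> \sum_(x : F) x ^+ #|F|.-1 = -1.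
Proof.
move=> F2; rewrite (bigD1 0) // expr0n gtn_eqF ?ltn_predRL 1?ltnW //=.
rewrite add0r (eq_bigr (fun=> 1)) => [|x x0]; last by rewrite expf_card_pred.
by rewrite sumr_const cardC1 natr_card_finField_pred.
Qed.

Lemma sum_geometric (F : finFieldType) (z : F) :
  z != 0 -> \sum_(n < #|F|.-1) z ^+ n = if z == 1 then -1 else 0.
Proof.
move=> z0; case: eqP => [->|/eqP z1].
  under eq_bigr do rewrite expr1n.
  by rewrite sumr_const card_ord natr_card_finField_pred.
have := subrX1 z #|F|.-1; rewrite expf_card_pred // subrr => /esym/eqP.
by rewrite mulf_eq0 subr_eq0 (negPf z1) => /eqP.
Qed.

(** * Sums of simple fractions, with the pole inside or outside the field *)

(** Write x^m = a^m + (x - a) Q(x) with deg Q < #|F| - 1. The sums of 1/(x - a) and of Q both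
    vanish; what remains is -Q(a), because the term at [x = a] is 0 by the convention 1/0 = 0. *)
Lemma sum_pow_div_sub (F : finFieldType) (a : F) (m : nat) :
  (2 < #|F|)%N -> (m < #|F|)%N ->
  \sum_(x : F) x ^+ m / (x - a) = - (m%:R * a ^+ m.-1).
Proof.
move=> F2 mF.
pose Q (x : F) := \sum_(i < m) x ^+ (m.-1 - i) * a ^+ i.
have E x : x ^+ m / (x - a) =
    a ^+ m * (x - a)^-1 + Q x - (if x == a then Q a else 0).
  have [->|xa] := eqVneq x a; first by rewrite subrr invr0 !mulr0 add0r subrr.
  rewrite subr0 -[x ^+ m](subrK (a ^+ m)) subrXX -/(Q x).
  by field; rewrite subr_eq0.
under eq_bigr do rewrite E.
rewrite sumrB big_split /= -mulr_sumr.
have -> : \sum_(x : F) (x - a)^-1 = 0.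
  rewrite (reindex_inj (addIr a)) /=.
  under eq_bigr do rewrite addrK.
  rewrite (reindex_inj invr_inj) /=.
  rewrite (eq_bigr (fun x => x ^+ 1)) => [|x _]; last by rewrite invrK.
  by apply: sum_expf; lia.
rewrite -big_mkcond big_pred1_eq.
have -> : \sum_(x : F) Q x = 0.
  rewrite exchange_big big1 //= => i _.
  by rewrite -mulr_suml sum_expf ?mul0r //; lia.
rewrite mulr0 !add0r; congr (- _); rewrite /Q.
under eq_bigr => i _.
  rewrite -exprD subnK; last by have := ltn_ord i; lia.
  over.
by rewrite sumr_const card_ord mulr_natl.
Qed.

(** The first hypothesis makes [b] the Frobenius conjugate of [a], and [a != b] keeps [a] out of the
    image of [F]. There is then no pole, and the sum of 1/(x - a), no longer 0, carries the whole
    result. *)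
Lemma sum_pow_div_sub_ext (F : finFieldType) (K : fieldType)
    (f : {rmorphism F -> K}) (a b : K) (m : nat) :
  (forall x, (f x - a) ^+ #|F| = f x - b) -> a != b ->
  (2 < #|F|)%N -> (m < #|F|)%N ->
  \sum_(x : F) f x ^+ m / (f x - a) = a ^+ m / (b - a).
Proof.
move=> aF ab F2 mF.
have sum0 k : (k < #|F|.-1)%N -> \sum_(x : F) f x ^+ k = 0.
  move=> kF; under eq_bigr do rewrite -rmorphXn.
  by rewrite -rmorph_sum sum_expf // rmorph0.
have xa x : f x - a != 0.
  apply/eqP=> E; have := aF x; rewrite E expr0n gtn_eqF ?card_finField_gt0 //.
  by move/esym/eqP; rewrite -(subrK a (f x)) E add0r subr_eq0 (negPf ab).
have sumV : \sum_(x : F) (f x - a)^-1 = (b - a)^-1.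
  (* With q = #|F|, divide (x - a)^q = (x - a) + (a - b) by x - a. *)
  have V x : (f x - a)^-1 = (f x - a) ^+ #|F|.-1 / (a - b) - (a - b)^-1.
    rewrite -[X in _ = _ - X]mul1r -mulrBl; apply: (mulfI (xa x)).
    rewrite divff // mulrA mulrBr mulr1 -exprS prednK ?card_finField_gt0 // aF.
    by field; rewrite subr_eq0.
  under eq_bigr do rewrite V.
  rewrite sumrB -mulr_suml sumr_const -mulr_natl -(rmorph_nat f).
  rewrite natr_card_finField rmorph0 mul0r subr0.
  suff -> : \sum_(x : F) (f x - a) ^+ #|F|.-1 = -1.
    by rewrite mulN1r -invrN opprB.
  (* Only the leading power of [f x] in the binomial expansion has a nonzero sum. *)
  under eq_bigr do rewrite exprBn big_ord_recl subn0 !expr0 !mulr1 mul1r bin0.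
  rewrite big_split exchange_big /= [X in _ + X = _]big1 => [|i _].
    rewrite addr0; under eq_bigr do rewrite -rmorphXn.
    by rewrite -rmorph_sum sum_expf_card_pred // rmorphN rmorph1.
  rewrite sumrMnl -mulr_suml -mulr_sumr sum0 ?mulr0 ?mul0r ?mul0rn //.
  by rewrite ltn_subrL /=; apply: leq_ltn_trans (ltn_ord i).
under eq_bigr => x _.
  rewrite -[f x ^+ m](subrK (a ^+ m)) subrXX mulrDl mulrAC divff // mul1r.
  over.
rewrite big_split /= -mulr_sumr sumV exchange_big big1 ?add0r //= => i _.
by rewrite -mulr_suml sum0 ?mul0r //; lia.
Qed.

(** * Fourier analysis on the unit group *)

(* The coefficient of [z ^- n] in [h], see [mulcoef_expansion]. *)
Definition mulcoef (F : finFieldType) (h : F -> F) (n : nat) : F :=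
  - \sum_(x : F) x ^+ n * h x.

(** Fourier inversion: the powers are the characters of the unit group, whose order is -1 in [F];
    hence the sign in [mulcoef]. *)
Lemma mulcoef_expansion (F : finFieldType) (h : F -> F) (z : F) :
  h 0 = 0 -> z != 0 ->
  h z = \sum_(n < #|F|.-1) mulcoef h n * z^-1 ^+ n.
Proof.
move=> h0 z0; rewrite /mulcoef.
under eq_bigr do rewrite mulNr mulr_suml.
rewrite sumrN exchange_big (bigD1 z) //= [X in _ + X]big1 => [|x xz].
  rewrite addr0; under eq_bigr do rewrite mulrAC -exprMn divff // expr1n mul1r.
  rewrite sumr_const card_ord -mulr_natl natr_card_finField_pred.
  by rewrite mulN1r opprK.
have [->|x0] := eqVneq x 0.
  by rewrite big1 // h0 => i _; rewrite mulr0 mul0r.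
under eq_bigr do rewrite mulrAC -exprMn.
rewrite -mulr_suml sum_geometric ?mulf_neq0 ?invr_eq0 //.
rewrite (_ : (_ == 1) = false) ?mul0r //; apply/negbTE.
by apply: contra xz => /eqP xz1; rewrite -[x](divfK z0) xz1 mul1r.
Qed.

(** [u] enumerates the unit group, and the Vandermonde matrices of [u] and of its inverses
    diagonalize the matrix; they are inverse to each other up to the scalar -1. *)
Lemma det_mul_circulant (F : finFieldType) (n : nat) (u : 'I_n -> F)
    (h : F -> F) :
  n = #|F|.-1 -> (forall i, u i != 0) -> injective u -> h 0 = 0 ->
  \det (\matrix_(i, j) h (u i / u j)) = \prod_(m < n) mulcoef h m.
Proof.
move=> nF u0 u_inj h0.
have geo (z : F) : z != 0 -> \sum_(m < n) z ^+ m = if z == 1 then -1 else 0.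
  by rewrite nF; apply: sum_geometric.
pose A : 'M_n := \matrix_(m < n, j < n) u j ^+ m.
pose B : 'M_n := \matrix_(i < n, m < n) (u i)^-1 ^+ m.
have -> : \matrix_(i, j) h (u i / u j) =
    B *m diag_mx (\row_(m < n) mulcoef h m) *m A.
  apply/matrixP=> i j; rewrite mul_mx_diag !mxE.
  rewrite mulcoef_expansion ?mulf_neq0 ?invr_eq0 // -nF.
  apply: eq_bigr => m _; rewrite !mxE invfM invrK exprMn.
  by rewrite mulrA [_ * mulcoef _ _]mulrC.
have BA : B *m A = (-1)%:M.
  apply/matrixP=> i j; rewrite !mxE.
  under eq_bigr do rewrite !mxE -exprMn.
  rewrite geo ?mulf_neq0 ?invr_eq0 //.
  case: (eqVneq i j) => [->|ij]; first by rewrite mulVf // eqxx.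
  rewrite (_ : (_ == 1) = false) //; apply/negbTE.
  apply: contra ij => /eqP uij; apply/eqP/u_inj.
  by rewrite -[u j](mulVKf (u0 i)) uij mulr1.
have detBA : \det B * \det A = 1.
  by rewrite -det_mulmx BA det_scalar nF expf_card_pred // oppr_eq0 oner_eq0.
rewrite !det_mulmx mulrAC detBA mul1r det_diag.
by apply: eq_bigr => m _; rewrite mxE.
Qed.

Lemma prod_double (R : comPzRingType) (E : nat -> R) (k : nat) : (0 < k)%N ->
  \prod_(n < k.*2) E n = E 0 * E k * \prod_(1 <= n < k) (E n * E (k.*2 - n)%N).
Proof.
move=> k0; rewrite -(big_mkord xpredT) (@big_cat_nat _ _ _ k) /=; [|lia|lia].
rewrite big_ltn // (big_ltn (m := k)) /=; last by lia.
have -> : \prod_(k.+1 <= n < k.*2) E n = \prod_(1 <= n < k) E (k.*2 - n)%N.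
  rewrite big_nat_rev -{1}[k.+1]add1n big_addn.
  rewrite (_ : (k.*2 - k)%N = k); last by lia.
  by apply: eq_big_nat => i ik; congr E; lia.
by rewrite big_split mulrACA.
Qed.

(** * Reduction of the determinant modulo p *)

(* Equal to 1 / (x + 2 - 1/x) where that makes sense, and 0 at 0 and at the
   roots of x^2 + 2x - 1. *)
Definition hpell (F : finFieldType) (x : F) : F := x / (x ^+ 2 + 2 * x - 1).

Lemma mulcoef_hpell_sym (F : finFieldType) (n : nat) : (n <= #|F|.-1)%N ->
  mulcoef (@hpell F) (#|F|.-1 - n) = (-1) ^+ n * mulcoef (@hpell F) n.
Proof.
move=> nF; rewrite /mulcoef mulrN; congr (- _); rewrite mulr_sumr.
have inj : injective (fun x : F => - x^-1) by move=> x y /oppr_inj/invr_inj.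
rewrite (reindex_inj inj) /=; apply: eq_bigr => x _.
have [->|x0] := eqVneq x 0; first by rewrite /hpell invr0 oppr0 !mul0r !mulr0.
have -> : hpell (- x^-1) = hpell x.
  rewrite /hpell.
  have -> : (- x^-1) ^+ 2 + 2 * (- x^-1) - 1 =
      - ((x ^+ 2 + 2 * x - 1) / x ^+ 2).
    by field.
  by rewrite invrN invf_div mulNr mulrN opprK mulrA; congr (_ / _); field.
rewrite [RHS]mulrA; congr (_ * _).
have y0 : - x^-1 != 0 by rewrite oppr_eq0 invr_eq0.
rewrite -[_ ^+ (_ - _)](mulfK (expf_neq0 n y0)).
rewrite -exprD subnK // expf_card_pred // mul1r.
by rewrite -exprVn invrN invrK (exprNn x).
Qed.

Lemma D_mod_prime (p : nat) : prime p -> odd p ->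
  exists2 w : 'F_p, w != 0 &
  (D p 2 (-1))%:~R = w ^+ 2 * \prod_(n < p.-1) mulcoef (@hpell 'F_p) n.
Proof.
move=> p_pr p_odd.
have cardF := card_Fp p_pr.
pose u (i : 'I_p.-1) : 'F_p := i.+1%:R.
have uE i : u i = i.+1 :> nat.
  by rewrite val_Fp_nat // modn_small //; have := ltn_ord i; lia.
have u0 i : u i != 0 by rewrite -val_eqE /= uE.
have u_inj : injective u.
  by move=> i j /(congr1 val); rewrite /= !uE => -[] /val_inj.
(* The i-th row and the i-th column are both scaled by [(u i)^-1], so this product enters twice. *)
exists (\prod_i (u i)^-1).
  by apply/prodf_neq0 => i _; rewrite invr_eq0.
rewrite -(det_mul_circulant _ u0 u_inj) ?cardF //; last by rewrite /hpell mul0r.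
pose U := \row_i (u i)^-1.
have -> : \prod_i (u i)^-1 = \det (diag_mx U).
  by rewrite det_diag; apply: eq_bigr => i _; rewrite mxE.
rewrite expr2 mulrAC -!det_mulmx -det_map_mx; congr (\det _).
apply/matrixP=> i j; rewrite mul_mx_diag mul_diag_mx !mxE.
(* This also holds at 0, since [p - 2] is positive. *)
have inv (x : 'F_p) : x ^+ (p - 2) = x^-1.
  have p2 : (p - 2).+1 = p.-1 by move: (prime_gt1 p_pr) p_odd; lia.
  have [->|x0] := eqVneq x 0.
    rewrite invr0 expr0n (_ : (_ == _)%N = false) //.
    by move: (prime_gt1 p_pr) p_odd; lia.
  apply: (mulfI x0); rewrite divff // -exprS p2.
  by have := expf_card_pred x0; rewrite cardF.
rewrite rmorphXn inv /=.
rewrite !(rmorphD, rmorphM, rmorphXn, rmorphN) /= -!pmulrn -!/(u _) /hpell.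
move: (u i) (u j) (u0 i) (u0 j) => x y x0 y0.
have -> : (x / y) ^+ 2 + 2 * (x / y) - 1 =
    (x ^+ 2 + 2 * x * y - y ^+ 2) / y ^+ 2.
  by field.
rewrite invf_div !mulr1n mulN1r -mulr2n.
(* The quadratic form may vanish, so its inverse is kept opaque. *)
by set z := _^-1; move: z => z; field; rewrite y0.
Qed.

(** * Coefficients of [hpell] by partial fractions *)

(** The first term sums the partial fractions at the poles [a] and [b]. The second corrects the
    values at these poles, where [hpell] is 0 but the remaining fraction is not; the 8 is (a -
    b)^2. *)
Lemma mulcoef_hpell_split (F : finFieldType) (s : F) (n : nat) :
  s ^+ 2 = 2 -> 2 != 0 :> F -> (2 < #|F|)%N -> (n.+1 < #|F|)%N ->
  mulcoef (@hpell F) n =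
    n.+1%:R * ((-1 + s) ^+ n - (-1 - s) ^+ n) / (2 * s)
      - ((-1 + s) ^+ n.+1 + (-1 - s) ^+ n.+1) / 8.
Proof.
move=> s2 two0 F2 nF.
have s0 : s != 0 by apply: contraNneq two0 => s0; rewrite -s2 s0 expr0n.
pose a := -1 + s; pose b := -1 - s.
have E x : x ^+ n * hpell x =
    (x ^+ n.+1 / (x - a) - x ^+ n.+1 / (x - b)) / (2 * s)
    + (if x == a then a ^+ n.+1 / 8 else 0)
    + (if x == b then b ^+ n.+1 / 8 else 0).
  have -> : hpell x = x / ((x - a) * (x - b)).
    by rewrite /hpell; congr (_ / _); rewrite /a /b; ring: s2.
  have e8 : 8 = (a - b) ^+ 2 by rewrite /a /b; ring: s2.
  have e2 : 2 * s = a - b by rewrite /a /b; ring.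
  have ab : a - b != 0 by rewrite -e2 mulf_neq0.
  rewrite e8 e2.
  have [->|xa] := eqVneq x a.
    rewrite -subr_eq0 (negPf ab) subrr mul0r invr0 !mulr0.
    by field.
  have [->|xb] := eqVneq x b.
    rewrite subrr !(mulr0, invr0).
    by field; rewrite ab -opprB oppr_eq0.
  by rewrite exprS; field; rewrite ab !subr_eq0 xa xb.
rewrite /mulcoef; under eq_bigr do rewrite E.
rewrite !big_split /= -!big_mkcond !big_pred1_eq -mulr_suml sumrB.
rewrite !sum_pow_div_sub //=.
rewrite -/a -/b; ring.
Qed.

(** The last two hypotheses say that Frobenius exchanges [s] and [- s]. The poles are then conjugate
    and outside [F], so no correction terms arise. *)
Lemma mulcoef_hpell_nonsplit (F : finFieldType) (K : fieldType)
    (f : {rmorphism F -> K}) (s : K) (n : nat) :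
  s ^+ 2 = 2 -> 2 != 0 :> K -> (2 < #|F|)%N -> (n.+1 < #|F|)%N ->
  (forall x, (f x - s) ^+ #|F| = f x + s) ->
  (forall x, (f x + s) ^+ #|F| = f x - s) ->
  f (mulcoef (@hpell F) n) = ((-1 + s) ^+ n.+1 + (-1 - s) ^+ n.+1) / 8.
Proof.
move=> s2 two0 F2 nF sF NsF.
have s0 : s != 0 by apply: contraNneq two0 => s0; rewrite -s2 s0 expr0n.
pose a := -1 + s; pose b := -1 - s.
have e8 : 8 = (a - b) ^+ 2 by rewrite /a /b; ring: s2.
have e2 : 2 * s = a - b by rewrite /a /b; ring.
have ab : a - b != 0 by rewrite -e2 mulf_neq0.
have aF x : (f x - a) ^+ #|F| = f x - b.
  have := sF (x + 1); rewrite rmorphD rmorph1.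
  rewrite (_ : f x + 1 - s = f x - a); last by rewrite /a; ring.
  by move=> ->; rewrite /b; ring.
have bF x : (f x - b) ^+ #|F| = f x - a.
  have := NsF (x + 1); rewrite rmorphD rmorph1.
  rewrite (_ : f x + 1 + s = f x - b); last by rewrite /b; ring.
  by move=> ->; rewrite /a; ring.
have xa x : f x - a != 0.
  apply: contraNneq ab => xa; have := aF x.
  rewrite xa expr0n gtn_eqF ?card_finField_gt0 //= => fb.
  by rewrite (_ : a - b = f x - b - (f x - a)); [rewrite -fb xa subrr | ring].
have xb x : f x - b != 0 by rewrite -aF expf_neq0.
rewrite /mulcoef rmorphN rmorph_sum /=.
have E x : f (x ^+ n * hpell x) =
    (f x ^+ n.+1 / (f x - a) - f x ^+ n.+1 / (f x - b)) / (a - b).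
  have -> : hpell x = x / (x ^+ 2 + 2 * x - 1) by [].
  rewrite rmorphM rmorphXn fmorph_div rmorphB rmorphD rmorphXn rmorphM.
  rewrite rmorph1 rmorph_nat.
  have -> : f x ^+ 2 + 2 * f x - 1 = (f x - a) * (f x - b).
    by rewrite /a /b; ring: s2.
  rewrite exprS; by field; rewrite ab xa xb.
under eq_bigr do rewrite E.
rewrite -mulr_suml sumrB.
have nab : a != b by rewrite -subr_eq0.
rewrite (sum_pow_div_sub_ext aF) // (sum_pow_div_sub_ext bF) // 1?eq_sym //.
rewrite -/a -/b.
by rewrite e8 /=; field; rewrite ab -opprB oppr_eq0 ab.
Qed.

(** * The product of the coefficients up to squares *)

Lemma mulcoef_hpell_half_eq0 (F : finFieldType) (k : nat) :
  #|F|.-1 = k.*2 -> odd k -> 2 != 0 :> F -> mulcoef (@hpell F) k = 0.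
Proof.
move=> Fk k_odd two0; have := @mulcoef_hpell_sym F k.
rewrite Fk -addnn addnK leq_addl => /(_ isT).
rewrite -signr_odd k_odd expr1 mulN1r => /eqP.
by rewrite -addr_eq0 -mulr2n -mulr_natl mulf_eq0 (negPf two0) => /eqP.
Qed.

(** The indices n and 2k - n pair off, each pair giving (-1)^n e_n^2 = (i^n e_n)^2; only 0 and k
    stay alone. *)
Lemma prod_mulcoef_hpell (F : finFieldType) (k : nat) (i : F) :
  #|F|.-1 = k.*2 -> (0 < k)%N -> i ^+ 2 = -1 ->
  \prod_(n < k.*2) mulcoef (@hpell F) n =
    mulcoef (@hpell F) 0 * mulcoef (@hpell F) k
      * (\prod_(1 <= n < k) (i ^+ n * mulcoef (@hpell F) n)) ^+ 2.
Proof.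
move=> Fk k0 i2; rewrite prod_double // -prodrXl; congr (_ * _).
apply: eq_big_nat => n nk; rewrite -Fk.
rewrite mulcoef_hpell_sym; last by rewrite Fk; lia.
by rewrite exprMn exprAC i2 mulrCA -expr2.
Qed.

Lemma legendre_eqN1P (p : nat) (a : int) : prime p ->
  legendre a p = -1 <-> forall y : 'F_p, a%:~R != y ^+ 2.
Proof.
move=> p_pr; have chF := pchar_Fp p_pr.
have sqE (x : int) : (x ^+ 2 == a %[mod p])%Z = (a%:~R == x%:~R ^+ 2 :> 'F_p).
  rewrite eqz_mod_dvd (dvdz_pcharf chF) rmorphB rmorphXn /= subr_eq0.
  by rewrite eq_sym.
rewrite /legendre (dvdz_pcharf chF); split.
  case: eqP => // /eqP a0; case: ifPn => // noroot _ y.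
  have y_lt : (y < p)%N by rewrite -[X in (_ < X)%N](Fp_cast p_pr) ltn_ord.
  move/existsPn/(_ (Ordinal y_lt)): noroot; rewrite sqE /=.
  by rewrite -pmulrn natr_Zp.
move=> nsq; case: ifPn => [/eqP a0|_].
  by have := nsq 0; rewrite a0 expr0n eqxx.
case: ifPn => // /existsP[x]; rewrite sqE => xa.
by have := nsq x%:~R; rewrite xa.
Qed.

(** Such an [a] is a nonsquare; its powers will supply square and fourth roots of -1. *)
Lemma exists_expf_half (F : finFieldType) (k : nat) :
  #|F|.-1 = k.*2 -> (0 < k)%N -> exists2 a : F, a != 0 & a ^+ k = -1.
Proof.
move=> Fk k0; have [|a a0 ak] := @exists_expf_neq1 F k.
  by rewrite Fk; lia.
exists a => //; apply/eqP; move: (expf_card_pred a0).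
rewrite Fk -muln2 exprM => /eqP.
by rewrite -[X in _ == X](expr1n _ 2) eqf_sqr (negPf ak).
Qed.

(** * The product e_0 e_k for p = 1 and p = 5 modulo 8 *)

Lemma mulcoef_hpell_split_square (F : finFieldType) (k : nat) :
  #|F|.-1 = k.*2 -> (0 < k)%N -> (4 %| k)%N -> 2 != 0 :> F ->
  exists r : F, mulcoef (@hpell F) 0 * mulcoef (@hpell F) k = r ^+ 2.
Proof.
move=> Fk k0 k4 two0.
have [g g0 gk] := exists_expf_half Fk k0.
have four0 : 4 != 0 :> F by rewrite (natrM _ 2 2) mulf_neq0.
have eight0 : 8 != 0 :> F by rewrite (natrM _ 4 2) mulf_neq0.
have F2 : (2 < #|F|)%N by lia.
have kF : (k.+1 < #|F|)%N by lia.
(* A primitive eighth root of unity, so that (z + 1/z)^2 = 2 + z^2 + z^-2 = 2. *)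
pose z := g ^+ (k %/ 4); have z4 : z ^+ 4 = -1 by rewrite -exprM divnK.
have z0 : z != 0 by rewrite expf_neq0.
pose s := z + z^-1.
have s2 : s ^+ 2 = 2.
  have -> : s ^+ 2 = 2 + (z ^+ 4 + 1) / z ^+ 2 by rewrite /s; field.
  by rewrite z4 addNr mul0r addr0.
have e0 := mulcoef_hpell_split s2 two0 F2 (ltnW F2).
have ek := mulcoef_hpell_split s2 two0 F2 kF.
pose a := -1 + s; pose b := -1 - s; rewrite -/a -/b in e0 ek.
have ab : a * b = -1 by rewrite /a /b; ring: s2.
have absum : a + b = -2 by rewrite /a /b; ring.
have a0 : a != 0.
  by apply: contra_eqN ab => /eqP->; rewrite mul0r eq_sym oppr_eq0 oner_eq0.
have k_even : ~~ odd k by lia.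
have akbk : a ^+ k * b ^+ k = 1.
  by rewrite -exprMn ab -signr_odd (negPf k_even) expr0.
have ak2 : a ^+ k * a ^+ k = 1.
  by rewrite -exprD addnn -Fk expf_card_pred.
(* This equality kills the first term of the split formula at [n = k]. *)
have bk : b ^+ k = a ^+ k by apply: (mulfI (expf_neq0 k a0)); rewrite akbk ak2.
have e0E : mulcoef (@hpell F) 0 = 4^-1.
  rewrite e0 !expr0 subrr mulr0 mul0r sub0r !expr1 absum mulNr opprK.
  by field; rewrite four0 eight0.
have ekE : mulcoef (@hpell F) k = a ^+ k / 4.
  rewrite ek bk subrr mulr0 mul0r sub0r !exprSr bk -mulrDr absum.
  by field; rewrite four0 eight0.
rewrite e0E ekE.
have : (a ^+ k == 1) || (a ^+ k == -1) by rewrite -sqrf_eq1 expr2 ak2.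
case/orP=> /eqP->.
  by exists 4^-1; field.
by exists (z ^+ 2 / 4); rewrite -z4; field.
Qed.

(** Since 2 = -i (1 + i)^2, the power is (-i)^k = (-1)^(k/2) with k/2 odd. So 2 is a nonsquare. *)
Lemma expf_half_two (F : finFieldType) (k : nat) (i : F) :
  #|F|.-1 = k.*2 -> (k = 2 %[mod 4])%N -> i ^+ 2 = -1 -> 2 != 0 :> F ->
  2 ^+ k = -1 :> F.
Proof.
move=> Fk k4 i2 two0.
have i0 : i != 0.
  by apply: contra_eqN i2 => /eqP->; rewrite expr0n eq_sym oppr_eq0 oner_eq0.
have i1sq : (1 + i) ^+ 2 = 2 * i by ring: i2.
have i10 : 1 + i != 0 by rewrite -sqrf_eq0 i1sq mulf_neq0.
have -> : 2 = (1 + i) ^+ 2 * - i by ring: i2.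
rewrite exprMn -exprM mul2n -Fk expf_card_pred // mul1r.
have -> : k = (2 * k./2)%N by lia.
by rewrite exprM sqrrN i2 -signr_odd (_ : odd _) //; lia.
Qed.

(** Frobenius swaps the poles, so a^(p+1) = ab = -1. Thus a^(k+1) and b^(k+1) are square roots of -1
    with product -1, and the square of their half-sum is (-1 - 1 - 2)/4 = -1. *)
Lemma mulcoef_hpell_inert (p k : nat) :
  prime p -> p.-1 = k.*2 -> (k = 2 %[mod 4])%N ->
  [/\ forall n, (n < p.-1)%N -> mulcoef (@hpell 'F_p) n != 0,
      mulcoef (@hpell 'F_p) 0 = - 4^-1
    & (4 * mulcoef (@hpell 'F_p) k) ^+ 2 = -1].
Proof.
move=> p_pr pk k4.
have cardF := card_Fp p_pr; have p1 := prime_gt1 p_pr.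
have k0 : (0 < k)%N by lia.
have p2 : (2 < p)%N by lia.
have p_odd : odd p by lia.
have Fk : #|'F_p|.-1 = k.*2 by rewrite cardF.
have F2 : (2 < #|'F_p|)%N by rewrite cardF.
have [K [f _]] := countable_algebraic_closure 'F_p.
have two0F : 2 != 0 :> 'F_p.
  by rewrite -(dvdn_pcharf (pchar_Fp p_pr)) gtnNdvd.
have two0 : 2 != 0 :> K by rewrite -(rmorph_nat f) fmorph_eq0.
have [s s2] : exists s : K, s ^+ 2 = 2.
  have [s sE] := solve_monicpoly (fun n => if n == 0 then 2 else 0 : K)
    (isT : (0 < 2)%N).
  by exists s; rewrite sE !big_ord_recl big_ord0 /= expr0 mulr1 mul0r !addr0.
have chK : p \in [pchar K] by rewrite (fmorph_pchar f) pchar_Fp.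
have [g g0 gk] := exists_expf_half Fk k0.
have i2 : (g ^+ k./2) ^+ 2 = -1.
  by rewrite -exprM (_ : (k./2 * 2)%N = k) //; lia.
(* s^p = s (s^2)^k = s 2^k. *)
have sp : s ^+ p = - s.
  rewrite -[in LHS](prednK (ltnW p1)) pk exprS -mul2n exprM s2.
  rewrite -(rmorph_nat f) -rmorphXn (expf_half_two Fk k4 i2) //.
  by rewrite rmorphN rmorph1 mulrN1.
have frob (x : 'F_p) (y : K) : (f x + y) ^+ p = f x + y ^+ p.
  rewrite exprDn_pchar; last by rewrite pnatE.
  by rewrite -rmorphXn; have := expf_card x; rewrite cardF => ->.
have sF x : (f x - s) ^+ #|'F_p| = f x + s.
  by rewrite cardF frob exprNn -signr_odd p_odd expr1 mulN1r sp opprK.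
have NsF x : (f x + s) ^+ #|'F_p| = f x - s.
  by rewrite cardF frob sp.
pose a := -1 + s; pose b := -1 - s.
have ap : a ^+ p = b by have := NsF (-1); rewrite cardF rmorphN rmorph1.
have bp : b ^+ p = a by have := sF (-1); rewrite cardF rmorphN rmorph1.
have ab : a * b = -1 by rewrite /a /b; ring: s2.
have ek n : (n < p.-1)%N ->
    f (mulcoef (@hpell 'F_p) n) = (a ^+ n.+1 + b ^+ n.+1) / 8.
  move=> np; rewrite (mulcoef_hpell_nonsplit s2 two0) // cardF; lia.
have four0 : 4 != 0 :> K by rewrite (natrM _ 2 2) mulf_neq0.
have eight0 : 8 != 0 :> K by rewrite (natrM _ 4 2) mulf_neq0.
have kp : (k.+1).*2 = p.+1 by lia.
have k1_odd : odd k.+1 by lia.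
have a2k : (a ^+ k.+1) ^+ 2 = -1 by rewrite -exprM muln2 kp exprSr ap mulrC.
have b2k : (b ^+ k.+1) ^+ 2 = -1 by rewrite -exprM muln2 kp exprSr bp.
have abk : a ^+ k.+1 * b ^+ k.+1 = -1.
  by rewrite -exprMn ab -signr_odd k1_odd expr1.
split.
- move=> n np; rewrite -(fmorph_eq0 f) ek // mulf_neq0 ?invr_eq0 //.
  apply/negP=> /eqP abm.
  (* [- a ^+ 2 = a / b] has odd order, as its power [k + 1] is 1. *)
  have : (- a ^+ 2) ^+ n.+1 = -1.
    rewrite exprNn -exprM mulnC exprM expr2.
    rewrite -{2}[a ^+ n.+1](addrK (b ^+ n.+1)) abm sub0r mulrN.
    by rewrite -exprMn ab mulrN -expr2 sqrr_sign.
  move/(congr1 (fun x => x ^+ k.+1)); rewrite exprAC.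
  rewrite exprNn -signr_odd k1_odd expr1 mulN1r exprAC a2k opprK expr1n => /eqP.
  by rewrite -subr_eq0 opprK -mulr2n (negPf two0).
- apply: (fmorph_inj f); rewrite ek; last by lia.
  rewrite rmorphN fmorphV rmorph_nat !expr1 /a /b; field.
  by rewrite four0 eight0.
- apply: (fmorph_inj f); rewrite rmorphXn rmorphM rmorph_nat ek; last by lia.
  rewrite rmorphN rmorph1.
  have -> : 4 * ((a ^+ k.+1 + b ^+ k.+1) / 8) = (a ^+ k.+1 + b ^+ k.+1) / 2.
    by field; rewrite two0 eight0.
  by rewrite expr_div_n sqrrD a2k b2k abk; field; rewrite four0.
Qed.

(** * The three cases: k odd, 4 dividing k, and k = 2 modulo 4 *)

Theorem corollary2p2 (p : nat) (p_prime : prime p) (p_odd : odd p) :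
  legendre (D p 2 (-1)) p = -1 <-> p = 5 %[mod 8].
Proof.
rewrite legendre_eqN1P //.
have [w w0 ->] := D_mod_prime p_prime p_odd.
have p1 := prime_gt1 p_prime.
have cardF := card_Fp p_prime.
pose k := p./2.
have pk : p.-1 = k.*2 by rewrite /k; lia.
have Fk : #|'F_p|.-1 = k.*2 by rewrite cardF.
have k0 : (0 < k)%N by rewrite /k; lia.
have two0 : 2 != 0 :> 'F_p.
  by rewrite -(dvdn_pcharf (pchar_Fp p_prime)) gtnNdvd //; lia.
rewrite pk.
have [k_odd|k_even] := boolP (odd k).
  (* The factor e_k is 0, so the determinant is 0 modulo p, which is a square. *)
  split=> [/(_ 0)|]; last by rewrite /k in k_odd; lia.
  have k_lt : (k < k.*2)%N by lia.
  rewrite (bigD1 (Ordinal k_lt)) //= mulcoef_hpell_half_eq0 //.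
  by rewrite mul0r mulr0 expr0n eqxx.
have [g g0 gk] := exists_expf_half Fk k0.
have i2 : (g ^+ k./2) ^+ 2 = -1.
  by rewrite -exprM (_ : (k./2 * 2)%N = k) //; lia.
rewrite (prod_mulcoef_hpell Fk k0 i2).
set P := \prod_(1 <= n < k) _.
have [k4|k4] := boolP (4 %| k)%N.
  split=> [nsq|]; last by rewrite /k in k4; lia.
  have [r er] := mulcoef_hpell_split_square Fk k0 k4 two0.
  by have := nsq (w * r * P); rewrite er !exprMn mulrA eqxx.
have k42 : (k = 2 %[mod 4])%N by lia.
split=> [_|_ y]; first by rewrite /k in k42; lia.
have [e_neq0 e0 ek2] := mulcoef_hpell_inert p_prime pk k42.
have four0 : 4 != 0 :> 'F_p by rewrite (natrM _ 2 2) mulf_neq0.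
have expk2 (x : 'F_p) : x != 0 -> (x ^+ 2) ^+ k = 1.
  by move=> x0; rewrite -exprM mul2n -Fk expf_card_pred.
have P0 : P != 0.
  rewrite prodf_seq_neq0; apply/allP=> n; rewrite mem_index_iota => nk.
  by rewrite mulf_neq0 ?e_neq0 ?expf_neq0 //; lia.
have ek0 : mulcoef (@hpell 'F_p) k != 0 by apply: e_neq0; lia.
have e00 : mulcoef (@hpell 'F_p) 0 != 0 by apply: e_neq0; lia.
apply/eqP=> E.
have y0 : y != 0.
  by rewrite -sqrf_eq0 -E !mulf_neq0 ?expf_neq0.
(* Euler's criterion: k-th powers of nonzero squares are 1, leaving (e_0 e_k)^k = 1. *)
move/(congr1 (fun x => x ^+ k)): E.
rewrite exprMn (expk2 w) // (expk2 y) // mul1r.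
rewrite exprMn (expk2 P) // mulr1 e0.
(* Up to a square, e_0 e_k is -v with v = 4 e_k and v^2 = -1, and (-v)^k = (-1)^(k/2) = -1. *)
have -> : - 4^-1 * mulcoef (@hpell 'F_p) k =
    - (4 * mulcoef (@hpell 'F_p) k) * 4^-1 ^+ 2.
  by field.
rewrite exprMn expk2 ?invr_eq0 // mulr1.
move: (4 * _) ek2 => v v2; rewrite (_ : k = (2 * k./2)%N); last by lia.
rewrite exprM sqrrN v2 -signr_odd (_ : odd _) ?expr1; last by lia.
by move/eqP; rewrite eq_sym -subr_eq0 opprK -mulr2n (negPf two0).
Qed.
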